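(* Let $i\in\{1,2,3,4\}$, with $P_i$ and $\mathcal{J}_i$ as defined in the context. Let $M$ be a finite dimensional $\mathcal{J}_i$-module, and define a $\mathbf{k}$-linear map $p_i$ on $M$ by $p_i(v)=yv$ for all $v\in M$. Then $(M,p_i)$ (with $M$ regarded as a $\mathbf{k}[x]$-module through the action of $x$) is a $(\mathbf{k}[x],P_i)$-module. Conversely, if $(M,p_i)$ is a finite dimensional $(\mathbf{k}[x],P_i)$-module and we define $yv=p_i(v)$ for all $v\in M$ (with $x$ acting by the given $\mathbf{k}[x]$-module structure), then $M$ is a $\mathcal{J}_i$-module.
   Context: $\mathbf{k}$ is an algebraically closed field of characteristic zero; $\mathbb{N}$ denotes the nonnegative integers. The $\mathbf{k}$-linear operators $P_i:\mathbf{k}[x]\to\mathbf{k}[x]$, which are Rota-Baxter operators of weight $1$, are given on monomials by: $P_1(x^n)=(-1)^{1-n}b^n$ for all $n\in\mathbb{N}$, where $b\in\mathbf{k}\setminus\{0\}$ is fixed; $P_2(x^n)=-x^n$ for all $n\in\mathbb{N}$; $P_3(1)=0$ and $P_3(x^n)=-x^n$ for $n\ge 1$; $P_4(1)=-1$ and $P_4(x^n)=0$ for $n\geq 1$. A $(\mathbf{k}[x],P_i)$-module is a pair $(M,p_i)$ where $M$ is a $\mathbf{k}[x]$-module and $p_i\in\mathrm{End}_{\mathbf{k}}(M)$ satisfies $P_i(f)p_i(v)=p_i(P_i(f)v+fp_i(v)+fv)$ for all $f\in\mathbf{k}[x]$, $v\in M$. All such modules are assumed finite dimensional over $\mathbf{k}$.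 $\mathbf{k}\langle x,y\rangle$ is the noncommutative (unital) polynomial algebra in $x,y$, containing $\mathbf{k}[x]$; $I_{P_i}$ is its two-sided ideal generated by $\{P_i(f)y-yP_i(f)-yfy-yf\mid f\in\mathbf{k}[x]\}$, and $\mathcal{J}_i=\mathbf{k}\langle x,y\rangle/I_{P_i}$. Modules over unital algebras are left unital modules. *)

(* Defs.v *)
From HB Require Import structures.
From mathcomp Require Import all_boot all_algebra.
From mathcomp Require Import ring_quotient.
From mathcomp Require Import boolp.
From mathcomp.multinomials Require Import monalg.

Set Implicit Arguments.
Unset Strict Implicit.
Unset Printing Implicit Defensive.

Import GRing.Theory.
Local Open Scope ring_scope.
Local Open Scope quotient_scope.

Section TwoSidedIdeal.
Variables (k : comNzRingType) (A : algType k).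

Record two_sided_ideal (I : A -> Prop) : Prop := TwoSidedIdeal {
  two_sided0 : I 0;
  two_sidedB : forall a b, I a -> I b -> I (a - b);
  two_sidedMl : forall a b, I b -> I (a * b);
  two_sidedMr : forall a b, I a -> I (a * b)
}.

Definition gen_ideal_prop (S : A -> Prop) (a : A) : Prop :=
  forall I : A -> Prop, two_sided_ideal I -> (forall s, S s -> I s) -> I a.

Definition gen_ideal (S : A -> Prop) : {pred A} :=
  fun a => `[< gen_ideal_prop S a >].

Lemma gen_idealP S a : reflect (gen_ideal_prop S a) (a \in gen_ideal S).
Proof. exact: asboolP. Qed.

Lemma gen_ideal_prop_ideal S : two_sided_ideal (gen_ideal_prop S).
Proof.
split=> [I Iid _|a b Ia Ib I Iid SI|a b Ib I Iid SI|a b Ia I Iid SI].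
- exact: (two_sided0 Iid).
- exact: (two_sidedB Iid (Ia I Iid SI) (Ib I Iid SI)).
- exact: (two_sidedMl Iid a (Ib I Iid SI)).
- exact: (two_sidedMr Iid b (Ia I Iid SI)).
Qed.

Lemma gen_ideal_gen (S : A -> Prop) a : S a -> a \in gen_ideal S.
Proof. by move=> Sa; apply/gen_idealP => I _; apply. Qed.

Lemma gen_ideal_zmod_closed S : zmod_closed (gen_ideal S).
Proof.
have [H0 HB _ _] := gen_ideal_prop_ideal S.
split; first exact/gen_idealP.
by move=> a b /gen_idealP Ia /gen_idealP Ib; apply/gen_idealP; exact: HB.
Qed.

HB.instance Definition _ S :=
  GRing.isZmodClosed.Build A (gen_ideal S) (gen_ideal_zmod_closed S).

Lemma gen_idealMl S a b : b \in gen_ideal S -> a * b \in gen_ideal S.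
Proof.
by move=> /gen_idealP Ib; apply/gen_idealP; apply: (two_sidedMl (gen_ideal_prop_ideal S)).
Qed.

Lemma gen_idealMr S a b : a \in gen_ideal S -> a * b \in gen_ideal S.
Proof.
by move=> /gen_idealP Ia; apply/gen_idealP; apply: (two_sidedMr (gen_ideal_prop_ideal S)).
Qed.

End TwoSidedIdeal.

(* [ring_quotient] builds the additive quotient for any additive subgroup, but
   the ring structure only for proper ideals of commutative rings. *)
Section QuotientAlgebra.
Variables (k : comNzRingType) (A : algType k) (S : A -> Prop).

Definition quot_alg : Type := {ideal_quot (gen_ideal S)}.
HB.instance Definition _ := GRing.Zmodule.on quot_alg.
HB.instance Definition _ : EqQuotient A (Quotient.equiv (gen_ideal S)) quot_alg :=
  EqQuotient.on quot_alg.

Definition quot_pi (a : A) : quot_alg := \pi_quot_alg a.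

Lemma quot_pi_eq a b : (quot_pi a = quot_pi b) <-> (a - b \in gen_ideal S).
Proof.
rewrite Quotient.idealrBE; split; first by move/eqP.
by move/eqP.
Qed.

Lemma quot_piK q : quot_pi (repr q) = q.
Proof. exact: reprK. Qed.

Lemma quot_pi_is_zmod_morphism : zmod_morphism quot_pi.
Proof.
move=> a b; rewrite /quot_pi.
by rewrite [LHS](Quotient.pi_add (gen_ideal S)) (Quotient.pi_opp (gen_ideal S)).
Qed.
HB.instance Definition _ :=
  GRing.isZmodMorphism.Build A quot_alg quot_pi quot_pi_is_zmod_morphism.

Definition quot_one : quot_alg := quot_pi 1.
Definition quot_mul (p q : quot_alg) : quot_alg := quot_pi (repr p * repr q).
Definition quot_scale (c : k) (q : quot_alg) : quot_alg := quot_pi (c *: repr q).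

Lemma quot_repr a : repr (quot_pi a) - a \in gen_ideal S.
Proof. by apply/quot_pi_eq; rewrite quot_piK. Qed.

Lemma quot_mulE a b : quot_mul (quot_pi a) (quot_pi b) = quot_pi (a * b).
Proof.
apply/quot_pi_eq.
rewrite -[X in X - _](addrNK (a * repr (quot_pi b))) -mulrBl -addrA -mulrBr.
by apply: rpredD; [apply: gen_idealMr|apply: gen_idealMl]; apply: quot_repr.
Qed.

Lemma quot_scaleE c a : quot_scale c (quot_pi a) = quot_pi (c *: a).
Proof.
apply/quot_pi_eq; rewrite -scalerBr -mulr_algl.
by apply: gen_idealMl; apply: quot_repr.
Qed.

Lemma quot_mulA : associative quot_mul.
Proof.
by move=> p q r; rewrite -[p]quot_piK -[q]quot_piK -[r]quot_piK !quot_mulE mulrA.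
Qed.
Lemma quot_mul1 : left_id quot_one quot_mul.
Proof. by move=> p; rewrite -[p]quot_piK quot_mulE mul1r. Qed.
Lemma quot_mulr1 : right_id quot_one quot_mul.
Proof. by move=> p; rewrite -[p]quot_piK quot_mulE mulr1. Qed.
Lemma quot_mulDl : left_distributive quot_mul +%R.
Proof.
move=> p q r; rewrite -[p]quot_piK -[q]quot_piK -[r]quot_piK.
by rewrite -raddfD !quot_mulE mulrDl raddfD.
Qed.
Lemma quot_mulDr : right_distributive quot_mul +%R.
Proof.
move=> p q r; rewrite -[p]quot_piK -[q]quot_piK -[r]quot_piK.
by rewrite -raddfD !quot_mulE mulrDr raddfD.
Qed.
HB.instance Definition _ := GRing.Zmodule_isPzRing.Build quot_alg
  quot_mulA quot_mul1 quot_mulr1 quot_mulDl quot_mulDr.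

Lemma quot_pi_is_monoid_morphism : monoid_morphism quot_pi.
Proof. by split=> // a b; rewrite [RHS]quot_mulE. Qed.
HB.instance Definition _ :=
  GRing.isMonoidMorphism.Build A quot_alg quot_pi quot_pi_is_monoid_morphism.

Lemma quot_scaleA a b q : quot_scale a (quot_scale b q) = quot_scale (a * b) q.
Proof. by rewrite -[q]quot_piK !quot_scaleE scalerA. Qed.
Lemma quot_scale1 : left_id 1 quot_scale.
Proof. by move=> q; rewrite -[q]quot_piK quot_scaleE scale1r. Qed.
Lemma quot_scaleDr : right_distributive quot_scale +%R.
Proof.
move=> c p q; rewrite -[p]quot_piK -[q]quot_piK.
by rewrite -raddfD !quot_scaleE scalerDr raddfD.
Qed.
Lemma quot_scaleDl q : {morph quot_scale^~ q : a b / a + b}.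
Proof. by move=> a b; rewrite -[q]quot_piK !quot_scaleE scalerDl raddfD. Qed.
HB.instance Definition _ := GRing.Zmodule_isLmodule.Build k quot_alg
  quot_scaleA quot_scale1 quot_scaleDr quot_scaleDl.

Lemma quot_pi_is_scalable : scalable quot_pi.
Proof. by move=> c a; rewrite [RHS]quot_scaleE. Qed.
HB.instance Definition _ :=
  GRing.isScalable.Build k A quot_alg *:%R quot_pi quot_pi_is_scalable.

Lemma quot_scalerAl (c : k) (p q : quot_alg) : c *: (p * q) = (c *: p) * q.
Proof.
by rewrite -[p]quot_piK -[q]quot_piK -rmorphM -!linearZ /= -rmorphM scalerAl.
Qed.

Lemma quot_scalerAr (c : k) (p q : quot_alg) : c *: (p * q) = p * (c *: q).
Proof.
by rewrite -[p]quot_piK -[q]quot_piK -rmorphM -!linearZ /= -rmorphM scalerAr.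
Qed.

(* Mathcomp's [algType] excludes the zero ring, which [quot_alg] may be, hence
   the explicit structure map instead of [in_alg]. *)
Definition quot_in_alg (c : k) : quot_alg := c *: (1 : quot_alg).

Lemma quot_in_alg_is_zmod_morphism : zmod_morphism quot_in_alg.
Proof. by move=> a b; rewrite /quot_in_alg scalerBl. Qed.
HB.instance Definition _ :=
  GRing.isZmodMorphism.Build k quot_alg quot_in_alg quot_in_alg_is_zmod_morphism.

Lemma quot_in_alg_is_monoid_morphism : monoid_morphism quot_in_alg.
Proof.
split=> [|a b]; rewrite /quot_in_alg ?scale1r //.
by rewrite -quot_scalerAl mul1r scalerA.
Qed.
HB.instance Definition _ := GRing.isMonoidMorphism.Build k quot_alg
  quot_in_alg quot_in_alg_is_monoid_morphism.

End QuotientAlgebra.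

Definition restrict (A B : pzRingType) (f : {rmorphism A -> B}) (M : lmodType B) :
  Type := M.

Section Restriction.
Variables (A B : pzRingType) (f : {rmorphism A -> B}) (M : lmodType B).

Local Notation fM := (restrict f M).
HB.instance Definition _ := GRing.Zmodule.on fM.

Definition restrict_scale (a : A) (v : fM) : fM := f a *: (v : M).

Lemma restrict_scaleA a b v :
  restrict_scale a (restrict_scale b v) = restrict_scale (a * b) v.
Proof. by rewrite /restrict_scale rmorphM scalerA. Qed.
Lemma restrict_scale1 : left_id 1 restrict_scale.
Proof. by move=> v; rewrite /restrict_scale rmorph1 scale1r. Qed.
Lemma restrict_scaleDr : right_distributive restrict_scale +%R.
Proof. by move=> a u v; exact: scalerDr. Qed.
Lemma restrict_scaleDl v : {morph restrict_scale^~ v : a b / a + b}.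
Proof. by move=> a b; rewrite /restrict_scale rmorphD scalerDl. Qed.
HB.instance Definition _ := GRing.Zmodule_isLmodule.Build A fM
  restrict_scaleA restrict_scale1 restrict_scaleDr restrict_scaleDl.

End Restriction.

Definition finite_dim (k : fieldType) (A : pzRingType) (f : {rmorphism k -> A})
    (M : lmodType A) : Prop :=
  exists n : nat, inhabited (Vector.axiom n (restrict f M)).

(* The fields of the factory [GRing.Zmodule_isLmodule], as a type over which one
   can quantify for an abstract [V]. *)
Record module_on (A : pzRingType) (V : zmodType) : Type := ModuleOn {
  module_scale : A -> V -> V;
  module_scaleA : forall a b v,
    module_scale a (module_scale b v) = module_scale (a * b) v;
  module_scale1 : left_id 1 module_scale;
  module_scaleDr : right_distributive module_scale +%R;
  module_scaleDl : forall v, {morph module_scale^~ v : a b / a + b}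
}.

Definition lmod_of (A : pzRingType) (V : zmodType) (m : module_on A V) : Type := V.
HB.instance Definition _ (A : pzRingType) (V : zmodType) (m : module_on A V) :=
  GRing.Zmodule.on (lmod_of m).
HB.instance Definition _ (A : pzRingType) (V : zmodType) (m : module_on A V) :=
  GRing.Zmodule_isLmodule.Build A (lmod_of m) (module_scaleA m)
    (module_scale1 m) (module_scaleDr m) (module_scaleDl m).

Section FreeAlgebra.
Variable k : comNzRingType.

(* k<x, y>, as the monoid algebra of the free monoid on two letters. *)
Definition free_alg : Type := {malg k[{fmonom 'I_2}]}.
HB.instance Definition _ := GRing.Lalgebra.on free_alg.

Definition free_gen (i : 'I_2) : free_alg := << fmu i >>.
Definition free_x : free_alg := free_gen 0.
Definition free_y : free_alg := free_gen 1.

Lemma free_scalerAr (c : k) (a b : free_alg) : c *: (a * b) = a * (c *: b).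
Proof.
suff comm_c g : g * c%:MP = c%:MP * g :> free_alg.
  by rewrite -!mul_malgC mulrA -[in RHS]comm_c mulrA comm_c mulrA.
rewrite !malgM_def fgmulUg fgmulgU; apply: eq_bigr => m _.
by rewrite mulrC mul1m mulm1.
Qed.
HB.instance Definition _ :=
  GRing.Lalgebra_isAlgebra.Build k free_alg free_scalerAr.

End FreeAlgebra.

Definition poly_to_free (k : comNzRingType) : {poly k} -> free_alg k :=
  horner_alg (free_x k).
HB.instance Definition _ (k : comNzRingType) :=
  GRing.LRMorphism.on (@poly_to_free k).

Section RotaBaxter.
Variable k : fieldType.

Definition monomial_ext (g : nat -> {poly k}) (f : {poly k}) : {poly k} :=
  \sum_(n < size f) f`_n *: g n.

Lemma monomial_extE g N (f : {poly k}) : (size f <= N)%N ->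
  monomial_ext g f = \sum_(n < N) f`_n *: g n.
Proof.
move=> leN; rewrite /monomial_ext.
rewrite -(big_mkord xpredT (fun n => f`_n *: g n)).
rewrite -(big_mkord xpredT (fun n => f`_n *: g n)) (big_cat_nat (leq0n _) leN) //=.
rewrite [X in _ + X]big_nat_cond [X in _ + X]big1 ?addr0 // => n.
by rewrite andbT => /andP[len _]; rewrite nth_default ?scale0r.
Qed.

Lemma monomial_ext_is_linear g : linear (monomial_ext g).
Proof.
move=> c p q; pose N := maxn (size p) (size q).
have le_pq : (size (c *: p + q)%R <= N)%N.
  rewrite (leq_trans (size_polyD _ _)) // geq_max leq_maxr andbT.
  by rewrite (leq_trans (size_scale_leq _ _)) ?leq_maxl.
rewrite (monomial_extE g le_pq) (monomial_extE g (leq_maxl _ (size q))).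
rewrite (monomial_extE g (leq_maxr (size p) _)) scaler_sumr -big_split /=.
by apply: eq_bigr => n _; rewrite coefD coefZ scalerDl scalerA.
Qed.
HB.instance Definition _ g := GRing.isLinear.Build k {poly k} {poly k} *:%R
  (monomial_ext g) (monomial_ext_is_linear g).

Lemma monomial_extXn g n : monomial_ext g 'X^n = g n.
Proof.
rewrite /monomial_ext size_polyXn big_ord_recr /= coefXn eqxx scale1r.
by rewrite big1 ?add0r // => i _; rewrite coefXn ltn_eqF ?scale0r.
Qed.

Variant rb_index := RB1 | RB2 | RB3 | RB4.

Definition rb_op (b : k) (i : rb_index) : {poly k} -> {poly k} :=
  match i with
  | RB1 => monomial_ext (fun n => (((-1) ^ (1 - n%:Z)) * b ^+ n)%:P)
  | RB2 => monomial_ext (fun n => - 'X^n)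
  | RB3 => monomial_ext (fun n => if n == 0%N then 0 else - 'X^n)
  | RB4 => monomial_ext (fun n => if n == 0%N then - 1 else 0)
  end.

Record is_rb_module (P : {poly k} -> {poly k}) (M : lmodType {poly k})
    (p : M -> M) : Prop := IsRBModule {
  rb_module_finite_dim : finite_dim (@polyC k) M;
  rb_module_linear : linear (p : restrict polyC M -> restrict polyC M);
  rb_module_eq : forall (f : {poly k}) (v : M),
    P f *: p v = p (P f *: v + f *: p v + f *: v)
}.

Definition rb_relation (P : {poly k} -> {poly k}) (u : free_alg k) : Prop :=
  exists f : {poly k}, let y := free_y k in let emb := @poly_to_free k in
    u = emb (P f) * y - y * emb (P f) - y * emb f * y - y * emb f.

Definition rb_alg (P : {poly k} -> {poly k}) : Type := quot_alg (rb_relation P).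
HB.instance Definition _ P := GRing.PzRing.on (rb_alg P).

Definition rb_y P : rb_alg P := quot_pi (rb_relation P) (free_y k).
Definition rb_const P : k -> rb_alg P := quot_in_alg (rb_relation P).
HB.instance Definition _ P := GRing.RMorphism.on (rb_const P).
Definition rb_poly P : {poly k} -> rb_alg P :=
  quot_pi (rb_relation P) \o @poly_to_free k.
HB.instance Definition _ P := GRing.RMorphism.on (rb_poly P).

End RotaBaxter.

(* Main.v *)
(* Read as an operator identity, "P(f)y - yP(f) - yfy - yf acts by 0" is exactly
   the Rota-Baxter module equation.  Conversely, the actions of x and y on M
   extend to the free algebra, the elements acting by 0 form a two-sided ideal,
   and this ideal contains the defining relations. *)
Require Import Defs.
From HB Require Import structures.
From mathcomp Require Import all_boot all_algebra.
From mathcomp Require Import finmap.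
From mathcomp.multinomials Require Import monalg.

Set Implicit Arguments.
Unset Strict Implicit.
Unset Printing Implicit Defensive.

Import GRing.Theory.
Local Open Scope ring_scope.

Section FreeAction.
Variables (k : comNzRingType) (V : lmodType k) (T : 'I_2 -> {linear V -> V}).

(** With [foldr] the last letter of the word acts first, so concatenation becomes composition, as
    for a left module. *)
Definition word_act (m : {fmonom 'I_2}) (v : V) : V := foldr (fun i => T i) v m.

Lemma word_act_is_linear m : linear (word_act m).
Proof.
by rewrite /word_act => c u v; elim: (m : seq _) => //= i s ->; rewrite linearP.
Qed.
HB.instance Definition _ m :=
  GRing.isLinear.Build k V V *:%R (word_act m) (word_act_is_linear m).

Lemma word_actM m1 m2 v : word_act (mmul m1 m2) v = word_act m1 (word_act m2 v).
Proof. by rewrite /word_act fmM foldr_cat. Qed.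

(** The vector comes first so that [free_act v] is a linear map on the free algebra. *)
Definition free_act (v : V) (g : free_alg k) : V :=
  \sum_(m <- msupp g) g@_m *: word_act m v.

(** Coefficients vanish off the support, so elements with different supports can be compared over
    one common finite set. *)
Lemma free_actEw v (g : free_alg k) (d : {fset {fmonom 'I_2}}) :
  (msupp g `<=` d)%fset -> free_act v g = \sum_(m <- d) g@_m *: word_act m v.
Proof.
move=> le_gd; rewrite [LHS](big_fset_incl _ le_gd) // => m _ /mcoeff_outdom ->.
by rewrite scale0r.
Qed.

Lemma free_act_is_linear v : linear (free_act v).
Proof.
move=> c g h; pose d := (msupp (c *: g + h)%R `|` (msupp g `|` msupp h))%fset.
have led : (msupp (c *: g + h)%R `<=` d)%fset by exact: fsubsetUl.
have leg : (msupp g `<=` d)%fset.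
  exact: fsubset_trans (fsubsetUl _ _) (fsubsetUr _ _).
have leh : (msupp h `<=` d)%fset.
  exact: fsubset_trans (fsubsetUr _ _) (fsubsetUr _ _).
rewrite (free_actEw _ led) (free_actEw _ leg) (free_actEw _ leh).
rewrite scaler_sumr -big_split; apply: eq_bigr => m _ /=.
by rewrite mcoeffD mcoeffZ scalerDl scalerA.
Qed.
HB.instance Definition _ v :=
  GRing.isLinear.Build k (free_alg k) V *:%R (free_act v) (free_act_is_linear v).

Lemma free_actDr g : {morph free_act^~ g : u v / u + v}.
Proof.
move=> u v; rewrite /free_act -big_split; apply: eq_bigr => m _ /=.
by rewrite linearD scalerDr.
Qed.

Lemma free_actU v c m : free_act v << c *g m >> = c *: word_act m v.
Proof. by rewrite (free_actEw v msuppU_le) big_seq_fset1 mcoeffUU. Qed.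

Lemma free_act1 v : free_act v 1 = v.
Proof. by rewrite [LHS]free_actU scale1r /word_act fm1. Qed.

Lemma free_act_gen v i : free_act v (free_gen k i) = T i v.
Proof. by rewrite [LHS]free_actU scale1r /word_act fmU. Qed.

(** Both factors expand into words, and on words this is [word_actM]. *)
Lemma free_actM v a b : free_act v (a * b) = free_act (free_act v b) a.
Proof.
rewrite {2}/free_act malgM_def fgmulEl1 linear_sum; apply: eq_bigr => m1 _ /=.
rewrite fgmulUg linear_sum /= {2}/free_act.
rewrite [in RHS]linear_sum scaler_sumr; apply: eq_bigr => m2 _.
by rewrite free_actU word_actM linearZ scalerA.
Qed.

(** For [a], [c] acting as [P f], [f] and [y] acting as [p], the right-hand side is the difference
    of the two sides of the module equation. *)
Lemma free_act_rb_relation v a c y :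
  free_act v (a * y - y * a - y * c * y - y * c)
  = free_act (free_act v y) a
    - free_act (free_act v a + free_act (free_act v y) c + free_act v c) y.
Proof. by rewrite 3!linearB /= !free_actM !free_actDr !opprD !addrA. Qed.

Variable S : free_alg k -> Prop.
Hypothesis S_act0 : forall s v, S s -> free_act v s = 0.

Lemma gen_ideal_act0 a v : a \in gen_ideal S -> free_act v a = 0.
Proof.
(* The ideal consists of elements killing every vector: closure under right multiplication by [d]
   uses the vanishing at [free_act u d], not only at [u]. *)
move=> /gen_idealP/(_ (fun a => forall v, free_act v a = 0)); apply; last first.
  by move=> s Ss u; apply: S_act0.
split=> [u|c d c0 d0 u|c d d0 u|c d c0 u].
- exact: linear0.
- by rewrite linearB /= c0 d0 subr0.
- by rewrite free_actM d0 /free_act big1 // => m _; rewrite linear0 scaler0.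
- by rewrite free_actM c0.
Qed.

Definition quot_act (q : quot_alg S) (v : V) : V := free_act v (repr q).

(** The chosen representative and [a] differ by an element of the ideal, which acts by zero. *)
Lemma quot_actE a v : quot_act (quot_pi S a) v = free_act v a.
Proof.
by apply/eqP; rewrite -subr_eq0 -linearB /= gen_ideal_act0 ?quot_repr.
Qed.

Lemma quot_actA a b v : quot_act a (quot_act b v) = quot_act (a * b) v.
Proof.
by rewrite -[a]quot_piK -[b]quot_piK -rmorphM !quot_actE free_actM.
Qed.

Lemma quot_act1 : left_id 1 quot_act.
Proof. by move=> v; rewrite -(rmorph1 (quot_pi S)) quot_actE free_act1. Qed.

Lemma quot_actDr : right_distributive quot_act +%R.
Proof. by move=> q u v; exact: free_actDr. Qed.

Lemma quot_actDl v : {morph quot_act^~ v : a b / a + b}.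
Proof.
move=> a b; rewrite -[a]quot_piK -[b]quot_piK -rmorphD !quot_actE.
exact: linearD.
Qed.

Definition quot_module : module_on (quot_alg S) V :=
  ModuleOn quot_actA quot_act1 quot_actDr quot_actDl.

End FreeAction.

Lemma rmorph_rb_relation (A B : pzRingType) (phi : {rmorphism A -> B}) (a c y : A) :
  phi (a * y - y * a - y * c * y - y * c)
  = phi a * phi y - phi y * (phi a + phi c * phi y + phi c).
Proof. by rewrite !rmorphB !rmorphM /= !mulrDr !opprD !addrA mulrA. Qed.

Section RBModules.
Variables (k : fieldType) (P : {poly k} -> {poly k}).

(** Identifies the two scalar actions of [k] on a module over the quotient: through its algebra
    structure and through constant polynomials. *)
Lemma rb_poly_polyC c : rb_poly P c%:P = rb_const P c.
Proof. by rewrite /rb_poly /= /poly_to_free horner_algC linearZ rmorph1. Qed.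

Lemma rb_relation_quot f :
  rb_poly P (P f) * rb_y P
  = rb_y P * (rb_poly P (P f) + rb_poly P f * rb_y P + rb_poly P f).
Proof.
pose emb := @poly_to_free k; pose y := free_y k.
pose u := emb (P f) * y - y * emb (P f) - y * emb f * y - y * emb f.
have u0 : quot_pi (rb_relation P) u = 0.
  rewrite -[RHS](raddf0 (quot_pi (rb_relation P))).
  by apply/quot_pi_eq; rewrite subr0; apply: gen_ideal_gen; exists f.
apply/eqP; rewrite -subr_eq0; apply/eqP; rewrite -[RHS]u0.
exact/esym/rmorph_rb_relation.
Qed.

(** Centrality of the scalars is what makes the action of [rb_y] linear over [k]. *)
Lemma rb_const_comm c q : rb_const P c * q = q * rb_const P c.
Proof.
by rewrite /rb_const /= /quot_in_alg -quot_scalerAl -quot_scalerAr mul1r mulr1.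
Qed.

Lemma rb_alg_module_is_rb_module (M : lmodType (rb_alg P)) :
  finite_dim (rb_const P) M ->
  is_rb_module P (M := restrict (rb_poly P) M) (fun v : M => rb_y P *: v).
Proof.
have scaleC c (v : M) :
    (c *: (v : restrict polyC (restrict (rb_poly P) M))) = rb_const P c *: v.
  by rewrite -rb_poly_polyC.
move=> [n [[v2r v2r_lin v2r_bij]]]; split.
(* The same coordinate map serves, since by [scaleC] both scalar actions agree. *)
- exists n; constructor; exists v2r => //.
  move=> c u v; rewrite -[RHS]v2r_lin; congr (v2r (_ + _)).
  exact: scaleC.
- move=> c u v; rewrite -[c *: u]/((c *: u : M)) scaleC.
  by rewrite [RHS]/(_ + _) scaleC scalerDr !scalerA rb_const_comm.
- move=> f v; rewrite -[LHS]/(rb_poly P (P f) *: (rb_y P *: v)).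
  by rewrite scalerA rb_relation_quot -scalerA !scalerDl -scalerA.
Qed.

Lemma rb_module_alg_module (M : lmodType {poly k}) (p : M -> M) :
  is_rb_module P p ->
  exists m : module_on (rb_alg P) M,
    (forall (f : {poly k}) (v : M), rb_poly P f *: (v : lmod_of m) = f *: v) /\
    (forall v : M, rb_y P *: (v : lmod_of m) = p v).
Proof.
(* The free algebra acts on the [k]-space [V] underlying [M]: x by ['X], y by [p]. *)
case=> _ p_lin p_eq; pose V : lmodType k := restrict polyC M.
pose x_act (v : V) : V := 'X *: (v : M).
have x_act_lin : linear x_act.
  move=> c u v; rewrite /x_act scalerDr; congr (_ + _).
  by rewrite [LHS]scalerA [RHS]scalerA mulrC.
pose X : {linear V -> V} :=
  HB.pack x_act (GRing.isLinear.Build k V V *:%R _ x_act_lin).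
pose Y : {linear V -> V} :=
  HB.pack (p : V -> V) (GRing.isLinear.Build k V V *:%R _ p_lin).
pose T (i : 'I_2) := if i == 0 then X else Y.
have act_y (v : V) : free_act T v (free_y k) = p v by rewrite free_act_gen.
have act_poly (f : {poly k}) (v : V) :
    free_act T v (poly_to_free f) = f *: (v : M).
  (* In [f * 'X + c%:P] the letter x acts first, so the induction hypothesis is needed at ['X *: v];
     hence [v] is generalized. *)
  elim/poly_ind: f v => [|f c IHf] v; first by rewrite rmorph0 linear0 scale0r.
  rewrite rmorphD rmorphM linearD /= free_actM.
  rewrite [poly_to_free 'X]horner_algX [poly_to_free _%:P]horner_algC.
  by rewrite linearZ /= free_act1 free_act_gen IHf scalerDl -scalerA.
have rel0 s v : rb_relation P s -> free_act T v s = 0.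
  case=> f ->.
  (* Abstracting the three elements keeps unification from unfolding them. *)
  move: (act_poly (P f)) (act_poly f) act_y.
  move: (poly_to_free (P f)) (poly_to_free f) (free_y k) => a c y act_a act_c act_y.
  rewrite free_act_rb_relation !act_y !act_c !act_a.
  by apply/eqP; rewrite subr_eq0; apply/eqP; exact: p_eq.
exists (quot_module rel0); split=> [f v|v].
- exact: (etrans (quot_actE rel0 _ _)).
- exact: (etrans (quot_actE rel0 _ _)).
Qed.

End RBModules.

Theorem proposition2p7 (k : closedFieldType) (k_char0 : [pchar k] =i pred0)
    (b : k) (b_neq0 : b != 0) (i : rb_index) :
  (forall M : lmodType (rb_alg (rb_op b i)),
     finite_dim (rb_const (rb_op b i)) M ->
     is_rb_module (rb_op b i) (M := restrict (rb_poly (rb_op b i)) M)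
       (fun v : M => rb_y (rb_op b i) *: v))
  /\
  (forall (M : lmodType {poly k}) (p : M -> M),
     is_rb_module (rb_op b i) p ->
     exists m : module_on (rb_alg (rb_op b i)) M,
       (forall (f : {poly k}) (v : M),
          rb_poly (rb_op b i) f *: (v : lmod_of m) = f *: v) /\
       (forall v : M, rb_y (rb_op b i) *: (v : lmod_of m) = p v)).
Proof.
split; first exact: rb_alg_module_is_rb_module.
exact: rb_module_alg_module.
Qed.
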